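(* Let $N\ge1$ be an integer, $V=\mathbb{R}$, $\lambda>0$ and $X_t=\lambda t$ for $t\in[0,N]$. Let $b^\pm\in T_1((\mathbb{R}))$ be the optimal forward ($+$) and backward ($-$) tensors of $X$ and $\bar b^\pm=(1,-\pi_1(b^\pm),\pi_2(b^\pm),\pi_3(b^\pm),\ldots)$. Then for all integers $l\ge1$ and $m\ge2$, $$\pi_l(b^\pm)=\lambda^l\frac{B_l^\pm}{l!},\qquad\pi_m(Z_N^\pm(\lambda t,\bar b^\pm))=\lambda^m\frac{B_m^\pm}{m!}.$$ If $\lambda=1$, then moreover for every $l\ge2$ and $t\in[0,N]$, $$\pi_l(Z_t^\pm(t,\bar b^\pm))=\frac1{l!}P_l(t-[t]),$$ and the generalised Euler–Maclaurin formula $$I_N^\pm(f,X)=\int_0^Nf(X_t)\mathrm{d}X_t+[f(X_t)\pi_1(b^\pm)]_{t=0}^N+\sum_{l=2}^m(-1)^l\big[f^{(l-1)}(X_t)\pi_l(Z_t^\pm(X,\bar b^\pm))\big]_{t=0}^N+(-1)^{m+1}\int_0^Nf^{(m)}(X_t)\,\mathrm{d}\pi_{m+1}(Z_t^\pm(X,\bar b^\pm))$$ for $f\in C^m(\mathbb{R})$, $m\ge1$, coincides with the classical Euler–Maclaurin formula $$\sum_{k\in[[0,N]]^\pm}f(k)=\int_0^Nf(s)\,\mathrm{d}s+\sum_{l=1}^m\frac{B_l^\pm}{l!}[f^{(l-1)}(x)]_{x=0}^N+\frac{(-1)^{m+1}}{m!}\int_0^Nf^{(m)}(s)P_m(s-[s])\,\mathrm{d}s,$$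 i.e. the sums on the left, the integrals, the boundary terms and the remainder terms of the two formulas agree respectively.
   Context: Bernoulli polynomials: $P_m(s)=\frac{\mathrm{d}^m}{\mathrm{d}x^m}\frac{xe^{sx}}{e^x-1}\big|_{x=0}$. Bernoulli numbers: $B_l^-=P_l(0)$, $B_1^+=-B_1^-=\frac12$, $B_l^+=B_l^-$ for $l\neq1$. $[[0,N]]^-=\{0,\ldots,N-1\}$, $[[0,N]]^+=\{1,\ldots,N\}$; $[g(t)]_{t=0}^N=g(N)-g(0)$; $[t]$ is the integer part of $t$. $I_N^-(f,X)=\sum_{k=0}^{N-1}f(X_k)(X_{k+1}-X_k)$, $I_N^+(f,X)=\sum_{k=0}^{N-1}f(X_{k+1})(X_{k+1}-X_k)$. For $V=\mathbb{R}$, $V^{\otimes n}=\mathbb{R}$ and $T_1((\mathbb{R}))$ is the set of real sequences $b=(1,b_1,b_2,\ldots)$ with $\pi_l(b)=b_l$; $\mathbf 1=(1,0,0,\ldots)$. Sawtooth signatures with initial datum $b$: $\pi_0(Z^\pm_t(X,b))=1$, $\pi_1(Z_t^+(X,b))=X_t-X_{[t]}+\pi_1(b)$, $\pi_1(Z_t^-(X,b))=X_t-X_{[t+1]}+\pi_1(b)$ (the value of $\pi_1(Z^-)$ at the single point $t=N$ is irrelevant here), and for $l\ge2$, $\mathrm{d}\pi_l(Z_t^\pm(X,b))=\pi_{l-1}(Z_t^\pm(X,b))\,\mathrm{d}X_t$ with $\pi_l(Z_0^\pm(X,b))=\pi_l(b)$. Optimal tensors ($X$ deterministic here, $|\mathrm{d}X_t|=\lambda\,\mathrm{d}t$):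 $\pi_0(b^\pm)=1$, $$\pi_1(b^\pm)=\frac{1}{\int_0^N|\mathrm{d}X_t|}\int_0^N\pi_1(Z_t^\pm(X,\mathbf 1))|\mathrm{d}X_t|,\qquad\pi_l(b^\pm)=-\frac{1}{\int_0^N|\mathrm{d}X_t|}\int_0^N\pi_l(Z_t^\pm(X,b^{\pm,<l}))|\mathrm{d}X_t|\quad(l\ge2),$$ where $b^{\pm,<l}=(1,-\pi_1(b^\pm),\pi_2(b^\pm),\ldots,\pi_{l-1}(b^\pm),0,0,\ldots)$. *)

(* Defs.v *)
From Stdlib Require Import Reals Lra Lia FunctionalExtensionality.
From mathcomp Require Import ssreflect seq.
From Coquelicot Require Import Coquelicot.
Open Scope R_scope.

(* Riemann-Stieltjes integral of [f] against [dg]: the limit, along the filter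
   used by Coquelicot's [is_RInt], of sums f(xi_i) (g(x_{i+1}) - g(x_i)). *)
Definition stieltjes_sum (f g : R -> R) (ptd : @SF_seq R) : R :=
  foldr Rplus 0
    (pairmap (fun p q => f (snd q) * (g (fst q) - g (fst p)))
       (SF_h ptd, 0) (SF_t ptd)).

Definition is_RSInt (f g : R -> R) (a b : R) (I : R) : Prop :=
  filterlim (fun ptd => sign (b - a) * stieltjes_sum f g ptd)
    (Riemann_fine a b) (locally I).

Definition RSInt (f g : R -> R) (a b : R) : R := iota (is_RSInt f g a b).

(* Total variation of [g] on [a, t], so that |dg| is d(total_variation g a). *)
Definition variation_sum (g : R -> R) (ptd : @SF_seq R) : R :=
  foldr Rplus 0
    (pairmap (fun p q => Rabs (g (fst q) - g (fst p)))
       (SF_h ptd, 0) (SF_t ptd)).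

Definition total_variation (g : R -> R) (a t : R) : R :=
  real (Lub_Rbar (fun v => exists ptd : @SF_seq R,
    pointed_subdiv ptd /\ SF_h ptd = a /\ last (SF_h ptd) (SF_lx ptd) = t /\
    v = variation_sum g ptd)).

(* x e^{sx} / (e^x - 1), continuously extended at x = 0. *)
Definition bernoulli_gen (s x : R) : R :=
  match Req_dec_T x 0 with
  | left _ => 1
  | right _ => x * exp (s * x) / (exp x - 1)
  end.

Definition bernoulli_poly (m : nat) (s : R) : R := Derive_n (bernoulli_gen s) m 0.

Inductive direction := forward | backward.

Definition bernoulli (d : direction) (l : nat) : R :=
  match d, l with
  | forward, 1%nat => - bernoulli_poly 1 0
  | _, _ => bernoulli_poly l 0
  end.

Definition boundary_jump (g : R -> R) (N : nat) : R := g (INR N) - g 0.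

Definition integer_range_sum (d : direction) (N : nat) (f : R -> R) : R :=
  match d with
  | forward => sum_n_m (fun k => f (INR k)) 1 N
  | backward => sum_n_m (fun k => f (INR k)) 0 (N - 1)
  end.

Definition euler_sum (d : direction) (N : nat) (f X : R -> R) : R :=
  sum_n_m (fun k =>
    f (X (INR (match d with forward => S k | backward => k end)))
      * (X (INR (S k)) - X (INR k))) 0 (N - 1).

(* An element b of T_1((R)) is the sequence l |-> pi_l(b). *)
Definition tensor_one (l : nat) : R := if Nat.eqb l 0 then 1 else 0.

Definition bar (b : nat -> R) (l : nat) : R := if Nat.eqb l 1 then - b l else b l.

(* [bar_below l b] is b^{<l} = (1, - b_1, b_2, ..., b_{l-1}, 0, 0, ...). *)
Definition bar_below (l : nat) (b : nat -> R) (k : nat) : R :=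
  if Nat.ltb k l then bar b k else 0.

Definition corner (d : direction) (t : R) : R :=
  match d with
  | forward => IZR (Int_part t)
  | backward => IZR (Int_part (t + 1))
  end.

(* [sawtooth d X b l t] is pi_l(Z_t(X, b)); for l >= 2 the equation
   d pi_l(Z) = pi_{l-1}(Z) dX, pi_l(Z_0) = pi_l(b), is taken in integrated form. *)
Fixpoint sawtooth (d : direction) (X : R -> R) (b : nat -> R) (l : nat) (t : R)
    {struct l} : R :=
  match l with
  | 0%nat => 1
  | S l' =>
      match l' with
      | 0%nat => X t - X (corner d t) + b 1%nat
      | S _ => b l + RSInt (sawtooth d X b l') X 0 t
      end
  end.

Definition path_mean (N : nat) (X g : R -> R) : R :=
  / RSInt (fun _ => 1) (total_variation X 0) 0 (INR N)
    * RSInt g (total_variation X 0) 0 (INR N).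

(* The recursion defining pi_l(b) uses all of pi_0(b), ..., pi_{l-1}(b):
   [optimal_prefix d N X l] is (1, b_1, ..., b_l, 0, 0, ...). *)
Fixpoint optimal_prefix (d : direction) (N : nat) (X : R -> R) (l : nat)
    {struct l} : nat -> R :=
  match l with
  | 0%nat => tensor_one
  | S l' =>
      let p := optimal_prefix d N X l' in
      fun k =>
        if Nat.eqb k l then
          match l' with
          | 0%nat => path_mean N X (sawtooth d X tensor_one 1)
          | S _ => - path_mean N X (sawtooth d X (bar_below l p) l)
          end
        else p k
  end.

Definition optimal_tensor (d : direction) (N : nat) (X : R -> R) (l : nat) : R :=
  optimal_prefix d N X l l.

Lemma optimal_tensor_0 d N X : optimal_tensor d N X 0 = 1.
Proof. reflexivity. Qed.

Lemma optimal_tensor_1 d N X :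
  optimal_tensor d N X 1 = path_mean N X (sawtooth d X tensor_one 1).
Proof. reflexivity. Qed.

Lemma optimal_prefix_stable d N X l k :
  (k <= l)%nat -> optimal_prefix d N X l k = optimal_tensor d N X k.
Proof.
elim: l => [|l IH] H; first by replace k with 0%nat by lia.
case: (Nat.eq_dec k (S l)) => [-> //|ne].
rewrite -IH; last by lia.
by rewrite /= (proj2 (Nat.eqb_neq k (S l)) ne).
Qed.

Lemma optimal_tensor_rec d N X l : (2 <= l)%nat ->
  optimal_tensor d N X l =
  - path_mean N X (sawtooth d X (bar_below l (optimal_tensor d N X)) l).
Proof.
case: l => [|[|l]] H; [lia | lia |].
have -> : bar_below (S (S l)) (optimal_tensor d N X) =
          bar_below (S (S l)) (optimal_prefix d N X (S l)).
{ apply functional_extensionality => k; rewrite /bar_below /bar.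
  case: (Nat.ltb_spec k (S (S l))) => // Hk.
  by rewrite optimal_prefix_stable; [|lia]. }
by rewrite {1}/optimal_tensor /= Nat.eqb_refl.
Qed.

Definition C_class (m : nat) (f : R -> R) : Prop :=
  (forall k x, (k <= m)%nat -> ex_derive_n f k x) /\
  (forall x, continuous (Derive_n f m) x).

(* Main.v *)
(* The function x e^(sx) / (e^x - 1) is e^(sx) divided by the entire function
   (e^x - 1) / x, hence smooth; differentiating it in s multiplies it by x, so
   P_(m+1)' = (m+1) P_m, its increment between s = 0 and s = 1 is x, so
   P_m(0) = P_m(1) for m >= 2, and x -> -x exchanges s = 0 and s = 1, so the odd
   Bernoulli numbers beyond the first vanish.  Therefore the periodised
   polynomials beta_m(t) = P_m(t - [t]) / m! are, for m >= 1, successive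
   primitives with mean zero over each period.  Both sawtooth signatures start
   from lambda beta_1 once the first level is corrected by the mean, and the
   optimal tensor chooses at each level the integration constant that makes the
   mean vanish, so level l is lambda^l beta_l.  Euler-Maclaurin is repeated
   integration by parts on unit intervals. *)
Require Import Defs.
From Stdlib Require Import Reals Factorial.
From Coquelicot Require Import Coquelicot.
From Stdlib Require Import Lra Lia FunctionalExtensionality.
Open Scope R_scope.

(** * Bernoulli polynomials *)

(** The entire function $(e^x-1)/x$, given by the shifted exponential series so that its behaviour
    at 0 needs no limit. *)
Definition exp_quotient : R -> R := PSeries (fun n => / INR (fact (S n))).

(** Shifting the index preserves the radius, so the ratio test is run on the exponential series
    itself. *)
Lemma exp_quotient_radius : CV_radius (fun n => / INR (fact (S n))) = p_infty.
Proof.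
  change (CV_radius (PS_decr_1 (fun n => / INR (fact n))) = p_infty).
  rewrite CV_radius_decr_1.
  apply CV_radius_infinite_DAlembert.
  - intros n; apply Rinv_neq_0_compat, INR_fact_neq_0.
  - apply is_lim_seq_ext with (fun n => / INR (S n)).
    + intros n; rewrite fact_simpl, mult_INR.
      assert (H1 := INR_fact_lt_0 n); assert (H2 := lt_0_INR (S n) ltac:(lia)).
      replace (/ (INR (S n) * INR (fact n)) / / INR (fact n)) with (/ INR (S n))
        by (field; lra).
      symmetry; apply Rabs_pos_eq, Rlt_le, Rinv_0_lt_compat, H2.
    + apply (is_lim_seq_incr_1 (fun n => / INR n)).
      apply (is_lim_seq_inv INR p_infty); [exact is_lim_seq_INR | discriminate].
Qed.

Lemma exp_quotient_spec x : exp x - 1 = x * exp_quotient x.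
Proof.
  assert (H := is_exp_Reals x).
  rewrite <- (is_pseries_unique _ _ _ H), PSeries_decr_1 by (eexists; exact H).
  change (PS_decr_1 (fun n => / INR (fact n))) with (fun n => / INR (fact (S n))).
  unfold exp_quotient; simpl; field.
Qed.

Lemma exp_quotient_0 : exp_quotient 0 = 1.
Proof. unfold exp_quotient; rewrite PSeries_0; simpl; field. Qed.

(** A zero away from the origin would force $e^x=1$, against injectivity of the exponential. *)
Lemma exp_quotient_neq_0 x : exp_quotient x <> 0.
Proof.
  intros H; destruct (Req_dec x 0) as [-> | Hx].
  - rewrite exp_quotient_0 in H; lra.
  - assert (E := exp_quotient_spec x); rewrite H, Rmult_0_r in E.
    apply Hx, exp_inv; rewrite exp_0; lra.
Qed.

Lemma exp_quotient_smooth n x : ex_derive_n exp_quotient n x.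
Proof.
  apply ex_derive_n_PSeries; rewrite exp_quotient_radius; exact I.
Qed.

(* A class of functions that contains [bernoulli_gen s] and is closed under
   derivation: smoothness of products and quotients comes for free. *)
Inductive elementary : (R -> R) -> Prop :=
| elementary_const c : elementary (fun _ => c)
| elementary_exp s : elementary (fun x => exp (s * x))
| elementary_quotient k : elementary (Derive_n exp_quotient k)
| elementary_inv : elementary (fun x => / exp_quotient x)
| elementary_plus f g :
    elementary f -> elementary g -> elementary (fun x => f x + g x)
| elementary_mult f g :
    elementary f -> elementary g -> elementary (fun x => f x * g x).

(** The constructors are chosen for this: all derivatives of $q$ = [exp_quotient] are members, and
    $(1/q)'$ is $-q'$ times two factors $1/q$. *)
Lemma elementary_is_derive f : elementary f ->
  exists f', elementary f' /\ forall x, is_derive f x (f' x).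
Proof.
  induction 1 as [c | s | k | | f g _ [f' [Ef Df]] _ [g' [Eg Dg]]
                 | f g Hf [f' [Ef Df]] Hg [g' [Eg Dg]]].
  - exists (fun _ => 0); split; [constructor | intros x; auto_derive; auto].
  - exists (fun x => s * exp (s * x)); split.
    + apply (elementary_mult (fun _ => s)); constructor.
    + intros x; auto_derive; [auto | ring].
  - exists (Derive_n exp_quotient (S k)); split; [constructor |].
    intros x; apply Derive_correct, (exp_quotient_smooth (S k)).
  - exists (fun x => (-1) * Derive_n exp_quotient 1 x *
                     ((/ exp_quotient x) * (/ exp_quotient x))); split.
    + apply (elementary_mult (fun x => (-1) * Derive_n exp_quotient 1 x)).
      * apply (elementary_mult (fun _ => -1)); constructor.
      * apply (elementary_mult (fun x => / exp_quotient x)); constructor.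
    + intros x.
      evar_last; [apply is_derive_inv;
        [apply Derive_correct, (exp_quotient_smooth 1) | apply exp_quotient_neq_0] |].
      change (Derive_n exp_quotient 1 x) with (Derive exp_quotient x).
      field; apply exp_quotient_neq_0.
  - exists (fun x => f' x + g' x); split; [now apply elementary_plus |].
    intros x; now apply (is_derive_plus f g).
  - exists (fun x => f' x * g x + f x * g' x); split.
    + apply elementary_plus; now apply elementary_mult.
    + intros x; apply (is_derive_mult f g); auto; intros; apply Rmult_comm.
Qed.

Lemma elementary_Derive f : elementary f -> elementary (Derive f).
Proof.
  intros [f' [Ef Df]]%elementary_is_derive.
  replace (Derive f) with f'; [exact Ef |].
  apply functional_extensionality; intros x; symmetry; now apply is_derive_unique.
Qed.

Lemma elementary_ex_derive f x : elementary f -> ex_derive f x.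
Proof.
  intros [f' [_ Df]]%elementary_is_derive; eexists; apply Df.
Qed.

Lemma elementary_Derive_n f n : elementary f -> elementary (Derive_n f n).
Proof. intros Ef; induction n; [exact Ef | now apply elementary_Derive]. Qed.

Lemma elementary_smooth f n x : elementary f -> ex_derive_n f n x.
Proof.
  intros Ef; destruct n; [exact I |].
  now apply elementary_ex_derive, elementary_Derive_n.
Qed.

Lemma Derive_n_S f n : Derive_n f (S n) = Derive_n (Derive f) n.
Proof.
  induction n as [| n IH]; [reflexivity |].
  apply functional_extensionality; intros x.
  change (Derive (Derive_n f (S n)) x = Derive (Derive_n (Derive f) n) x).
  now rewrite IH.
Qed.

Lemma elementary_Derive_n_plus f g n x : elementary f -> elementary g ->
  Derive_n (fun y => f y + g y) n x = Derive_n f n x + Derive_n g n x.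
Proof.
  intros Ef Eg; apply Derive_n_plus;
    apply filter_forall; intros; now apply elementary_smooth.
Qed.

(** Taking one derivative before the other n gives a recursion in which s is an explicit factor, so
    that it can be differentiated in s. *)
Lemma Derive_n_exp_mult_S u n x s : elementary u ->
  Derive_n (fun y => exp (s * y) * u y) (S n) x =
  s * Derive_n (fun y => exp (s * y) * u y) n x
  + Derive_n (fun y => exp (s * y) * Derive u y) n x.
Proof.
  intros Eu.
  assert (Ee := elementary_exp s).
  rewrite <- Derive_n_scal_l, <- elementary_Derive_n_plus, Derive_n_S.
  - apply Derive_n_ext; intros y; apply is_derive_unique.
    assert (Du := Derive_correct _ _ (elementary_ex_derive u y Eu)).
    evar_last; [apply (is_derive_mult (fun z => exp (s * z)) u) |].
    + auto_derive; [trivial | reflexivity].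
    + exact Du.
    + intros; apply Rmult_comm.
    + unfold plus, mult; simpl; ring.
  - apply (elementary_mult (fun _ => s)); [constructor | now apply elementary_mult].
  - apply elementary_mult; [exact Ee | now apply elementary_Derive].
Qed.

(** Formally, $\partial_s$ brings down a factor y, and Leibniz applied to $y\,e^{sy}u$ leaves two
    terms. Induction on n avoids exchanging derivatives; [u] is quantified inside it because the
    recursion passes to [Derive u]. For n = 0 the truncated [n - 1] is multiplied by [INR 0]. *)
Lemma is_derive_Derive_n_exp_mult n : forall u (s x : R), elementary u ->
  is_derive (fun s : R => Derive_n (fun y => exp (s * y) * u y) n x) s
    (x * Derive_n (fun y => exp (s * y) * u y) n x
     + INR n * Derive_n (fun y => exp (s * y) * u y) (n - 1) x).
Proof.
  induction n as [| n IH]; intros u s x Eu.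
  - simpl; auto_derive; [trivial | ring].
  - apply is_derive_ext with (fun s : R =>
      s * Derive_n (fun y => exp (s * y) * u y) n x
      + Derive_n (fun y => exp (s * y) * Derive u y) n x).
    { intros t; symmetry; now apply Derive_n_exp_mult_S. }
    evar_last.
    + apply (is_derive_plus (V := R_NormedModule)).
      * apply (is_derive_mult (fun s : R => s)
          (fun s : R => Derive_n (fun y => exp (s * y) * u y) n x)); [apply is_derive_id | now apply IH |].
        intros; apply Rmult_comm.
      * apply IH; now apply elementary_Derive.
    + rewrite Derive_n_exp_mult_S by exact Eu.
      unfold plus, mult, one; cbn -[INR Derive_n].
      rewrite Nat.sub_0_r, S_INR.
      destruct n as [| n]; [simpl; ring |].
      replace (S n - 1)%nat with n by lia.
      rewrite (Derive_n_exp_mult_S u n) by exact Eu.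
      ring.
Qed.

(** * Recursion, endpoint values and reflection of the Bernoulli polynomials *)

Lemma bernoulli_gen_eq s x : bernoulli_gen s x = exp (s * x) * / exp_quotient x.
Proof.
  unfold bernoulli_gen; destruct (Req_dec_T x 0) as [-> | Hx].
  - rewrite exp_quotient_0, Rmult_0_r, exp_0; field.
  - rewrite exp_quotient_spec; field; split; [apply exp_quotient_neq_0 | exact Hx].
Qed.

Lemma bernoulli_gen_elementary s : elementary (bernoulli_gen s).
Proof.
  replace (bernoulli_gen s) with (fun x => exp (s * x) * / exp_quotient x).
  - apply elementary_mult; constructor.
  - apply functional_extensionality; intros x; now rewrite bernoulli_gen_eq.
Qed.

Lemma bernoulli_poly_eq m s :
  bernoulli_poly m s = Derive_n (fun y => exp (s * y) * / exp_quotient y) m 0.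
Proof. apply Derive_n_ext; intros x; apply bernoulli_gen_eq. Qed.

(** At the base point 0 the term with factor x in [is_derive_Derive_n_exp_mult] drops out. *)
Lemma is_derive_bernoulli_poly m s :
  is_derive (bernoulli_poly (S m)) s (INR (S m) * bernoulli_poly m s).
Proof.
  apply is_derive_ext with
    (fun s => Derive_n (fun y => exp (s * y) * / exp_quotient y) (S m) 0).
  { intros t; now rewrite bernoulli_poly_eq. }
  evar_last; [apply is_derive_Derive_n_exp_mult; constructor |].
  rewrite bernoulli_poly_eq; replace (S m - 1)%nat with m by lia; ring.
Qed.

Lemma bernoulli_poly_0 s : bernoulli_poly 0 s = 1.
Proof.
  rewrite bernoulli_poly_eq; simpl.
  rewrite exp_quotient_0, Rmult_0_r, exp_0; field.
Qed.

Lemma continuous_bernoulli_poly m s : continuous (bernoulli_poly m) s.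
Proof.
  destruct m as [| m].
  - apply continuous_ext with (fun _ => 1); [| apply continuous_const].
    intros x; now rewrite bernoulli_poly_0.
  - apply (ex_derive_continuous (V := R_NormedModule)).
    eexists; apply is_derive_bernoulli_poly.
Qed.

Lemma bernoulli_gen_1 x : bernoulli_gen 1 x = bernoulli_gen 0 x + x.
Proof.
  rewrite !bernoulli_gen_eq, Rmult_0_l, exp_0, Rmult_1_l.
  replace (exp x) with (1 + x * exp_quotient x)
    by (rewrite <- exp_quotient_spec; ring).
  field; apply exp_quotient_neq_0.
Qed.

Lemma bernoulli_poly_1_minus_0 m :
  bernoulli_poly m 1 = bernoulli_poly m 0 + Derive_n (fun x => x) m 0.
Proof.
  unfold bernoulli_poly.
  (* The class has no constructor for the identity; it is recovered as the increment of the
     generating function between s = 0 and s = 1. *)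
  assert (E : elementary (fun x => x)).
  { replace (fun x : R => x) with
      (fun x => bernoulli_gen 1 x + (-1) * bernoulli_gen 0 x).
    - apply elementary_plus; [| apply (elementary_mult (fun _ => -1)); [constructor |]];
        apply bernoulli_gen_elementary.
    - apply functional_extensionality; intros x; rewrite bernoulli_gen_1; ring. }
  rewrite <- elementary_Derive_n_plus; [| apply bernoulli_gen_elementary | exact E].
  apply Derive_n_ext, bernoulli_gen_1.
Qed.

Lemma bernoulli_poly_1_eq_0 m : (2 <= m)%nat -> bernoulli_poly m 1 = bernoulli_poly m 0.
Proof.
  intros Hm; rewrite bernoulli_poly_1_minus_0.
  destruct m as [| [| m]]; [lia | lia |].
  rewrite Derive_n_S, (Derive_n_ext (Derive (fun x => x)) (fun _ => 1)).
  - rewrite Derive_n_const; ring.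
  - intros t; apply Derive_id.
Qed.

(** The generating function at s = 0 is the one at s = 1 composed with negation, and each derivative
    then brings a factor -1. *)
Lemma bernoulli_poly_reflection m :
  bernoulli_poly m 0 = (-1) ^ m * bernoulli_poly m 1.
Proof.
  unfold bernoulli_poly.
  (* The base point on the right becomes -0, the shape required by the rule for composition with
     negation. *)
  rewrite <- Ropp_0 at 3.
  rewrite <- Derive_n_comp_opp.
  - apply Derive_n_ext; intros x; unfold bernoulli_gen.
    destruct (Req_dec_T x 0) as [-> | Hx]; destruct (Req_dec_T (- _) 0); try lra.
    rewrite Rmult_0_l, exp_0, !Rmult_1_l, exp_Ropp.
    assert (exp x <> 1) by (intros H; apply Hx, exp_inv; rewrite exp_0; lra).
    assert (Hp := exp_pos x).
    field; repeat split; lra.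
  - apply filter_forall; intros; apply elementary_smooth, bernoulli_gen_elementary.
Qed.

Lemma bernoulli_poly_1_0 : bernoulli_poly 1 0 = - / 2.
Proof.
  assert (H1 := bernoulli_poly_reflection 1).
  assert (H2 := bernoulli_poly_1_minus_0 1).
  change (Derive_n (fun x => x) 1 0) with (Derive (fun x => x) 0) in H2.
  rewrite Derive_id in H2; lra.
Qed.

Lemma bernoulli_poly_1_1 : bernoulli_poly 1 1 = / 2.
Proof.
  assert (H1 := bernoulli_poly_reflection 1).
  rewrite bernoulli_poly_1_0 in H1; lra.
Qed.

(** Reflection combined with equal endpoint values; in this form the vanishing of odd Bernoulli
    numbers absorbs the signs in Euler-Maclaurin. *)
Lemma bernoulli_poly_0_parity m : (2 <= m)%nat ->
  (-1) ^ m * bernoulli_poly m 0 = bernoulli_poly m 0.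
Proof.
  intros Hm; rewrite (bernoulli_poly_reflection m) at 2.
  now rewrite bernoulli_poly_1_eq_0.
Qed.

Lemma bernoulli_poly_1 s : bernoulli_poly 1 s = s - / 2.
Proof.
  assert (H : is_RInt (fun _ => 1) 0 s (bernoulli_poly 1 s - bernoulli_poly 1 0)).
  { apply (is_RInt_derive (V := R_CompleteNormedModule)).
    - intros x _; evar_last; [apply is_derive_bernoulli_poly |].
      rewrite bernoulli_poly_0; simpl; ring.
    - intros x _; apply continuous_const. }
  apply (is_RInt_unique (V := R_CompleteNormedModule)) in H; rewrite RInt_const in H.
  unfold scal in H; simpl in H; unfold mult in H; simpl in H.
  rewrite bernoulli_poly_1_0 in H; lra.
Qed.

(** * Stieltjes integrals and total variation *)

Definition SF_end (s : @SF_seq R) : R := seq.last (SF_h s) (SF_lx s).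

(** Removing the leftmost cell while keeping its tag inequality lets the sums below be treated cell
    by cell. *)
Lemma pointed_subdiv_ind (P : @SF_seq R -> Prop) :
  (forall x, P (SF_nil x)) ->
  (forall x xi s, pointed_subdiv s -> x <= xi <= SF_h s -> P s ->
     P (SF_cons (x, xi) s)) ->
  forall s, pointed_subdiv s -> P s.
Proof.
  intros Hnil Hcons s; induction s as [x | [x xi] s IH] using SF_cons_ind; intros H.
  - apply Hnil.
  - assert (Hs := ptd_cons _ _ H).
    apply Hcons; [exact Hs | | exact (IH Hs)].
    apply (H 0%nat); rewrite SF_size_cons; lia.
Qed.

Lemma SF_end_cons h s : SF_end (SF_cons h s) = SF_end s.
Proof. reflexivity. Qed.

Lemma SF_h_le_end s : pointed_subdiv s -> SF_h s <= SF_end s.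
Proof.
  revert s; apply pointed_subdiv_ind; intros; [apply Rle_refl |].
  rewrite SF_end_cons; simpl; lra.
Qed.

Lemma seq_step_cons h (s : @SF_seq R) :
  seq_step (SF_lx (SF_cons h s)) = Rmax (Rabs (SF_h s - fst h)) (seq_step (SF_lx s)).
Proof. reflexivity. Qed.

Lemma stieltjes_sum_cons f g h s :
  stieltjes_sum f g (SF_cons h s) =
  f (snd h) * (g (SF_h s) - g (fst h)) + stieltjes_sum f g s.
Proof. destruct s as [x [| p l]]; reflexivity. Qed.

Lemma variation_sum_cons g h s :
  variation_sum g (SF_cons h s) =
  Rabs (g (SF_h s) - g (fst h)) + variation_sum g s.
Proof. destruct s as [x [| p l]]; reflexivity. Qed.

Lemma variation_sum_linear c s : 0 <= c -> pointed_subdiv s ->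
  variation_sum (fun t => c * t) s = c * (SF_end s - SF_h s).
Proof.
  intros Hc; revert s; apply pointed_subdiv_ind.
  - intros x; unfold variation_sum, SF_end; simpl; ring.
  - intros x xi s Hs Hx IH; rewrite variation_sum_cons, IH, SF_end_cons; simpl.
    rewrite Rabs_pos_eq; [ring |].
    rewrite <- Rmult_minus_distr_l; apply Rmult_le_pos; lra.
Qed.

(** The path is monotone, so the sum over any subdivision telescopes to the same value and the
    supremum is attained by a single cell. *)
Lemma total_variation_linear c a t : 0 <= c -> a <= t ->
  total_variation (fun t => c * t) a t = c * (t - a).
Proof.
  intros Hc Hat; unfold total_variation.
  rewrite (is_lub_Rbar_unique _ (c * (t - a))); [reflexivity |].
  split.
  - intros v [s [Hs [Ha [Ht ->]]]]; rewrite variation_sum_linear by assumption.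
    unfold SF_end; rewrite Ha, <- Ht, Ha; apply Rle_refl.
  - intros l Hl; apply Hl.
    exists (SF_cons (a, a) (SF_nil t)).
    assert (Hs : pointed_subdiv (SF_cons (a, a) (SF_nil t))).
    { intros [| i] Hi; [simpl; lra | unfold SF_size in Hi; simpl in Hi; lia]. }
    split; [exact Hs | do 2 (split; [reflexivity |])].
    now rewrite variation_sum_linear.
Qed.

(** * Evaluation of Stieltjes integrals *)

Lemma is_RSInt_unique f g a b I : is_RSInt f g a b I -> RSInt f g a b = I.
Proof.
  intros H; apply (iota_unique (V := R_CompleteNormedModule)); [| exact H].
  intros J HJ.
  exact (filterlim_locally_unique (K := R_AbsRing) (V := R_NormedModule)
    (FF := Proper_StrongProper _ (Riemann_fine_filter a b))
    (fun s => sign (b - a) * stieltjes_sum f g s) J I HJ H).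
Qed.

(** Linearity of [g] is asked on the interval only, because the total variation that serves as
    integrator in [path_mean] is computed only to the right of 0. *)
Lemma stieltjes_sum_linear f g c a b s :
  (forall x, a <= x <= b -> g x = c * x) -> pointed_subdiv s ->
  a <= SF_h s -> SF_end s <= b ->
  stieltjes_sum f g s = c * Riemann_sum (V := R_NormedModule) f s.
Proof.
  intros Hg Hs; revert s Hs; apply (pointed_subdiv_ind (fun s => _ -> _ -> _)).
  - intros x _ _; unfold stieltjes_sum, Riemann_sum, zero; simpl; ring.
  - intros x xi s Hs Hx IH; rewrite SF_end_cons; simpl; intros Ha Hb.
    assert (He := SF_h_le_end s Hs).
    rewrite stieltjes_sum_cons, Riemann_sum_cons, IH by lra; simpl.
    rewrite !Hg by lra.
    unfold plus, scal; simpl; unfold mult; simpl; ring.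
Qed.

Lemma is_RSInt_linear f g c a b I : a <= b ->
  (forall x, a <= x <= b -> g x = c * x) -> is_RInt f a b I ->
  is_RSInt f g a b (c * I).
Proof.
  intros Hab Hg HI; unfold is_RSInt, Riemann_fine.
  apply filterlim_within_ext with
    (fun s => scal c (scal (sign (b - a)) (Riemann_sum f s))).
  - intros s [Hs [Ha Hb]].
    rewrite Rmin_left in Ha by exact Hab; rewrite Rmax_right in Hb by exact Hab.
    rewrite (stieltjes_sum_linear f g c a b s Hg Hs).
    + unfold scal; simpl; unfold mult; simpl; ring.
    + rewrite Ha; apply Rle_refl.
    + unfold SF_end; rewrite Hb; apply Rle_refl.
  - eapply filterlim_comp; [exact HI |].
    apply (filterlim_scal_r (V := R_NormedModule)).
Qed.

(** On a cell with tag $\xi$ the error is the integral of $(f(\xi)-f)\varphi$, at most its length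
    times [eps * M]; the cells add up. The density is only bounded and integrable, so that the
    jumping $\beta_1$ is covered. *)
Lemma stieltjes_sum_density f g phi a b M eps (delta : posreal) s :
  0 <= eps ->
  (forall x y, a <= x <= b -> a <= y <= b -> Rabs (y - x) < delta ->
     Rabs (f x - f y) <= eps) ->
  (forall x, a <= x <= b -> Rabs (phi x) <= M) ->
  (forall x y, a <= x -> x <= y -> y <= b -> is_RInt phi x y (g y - g x)) ->
  ex_RInt (fun x => f x * phi x) a b ->
  pointed_subdiv s -> a <= SF_h s -> SF_end s <= b -> seq_step (SF_lx s) < delta ->
  Rabs (stieltjes_sum f g s - RInt (fun x => f x * phi x) (SF_h s) (SF_end s))
    <= (SF_end s - SF_h s) * (eps * M).
Proof.
  intros Heps Hf HM Hg Hex Hs; revert s Hs.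
  apply (pointed_subdiv_ind (fun s => _ -> _ -> _ -> _)).
  - intros x _ _ _; unfold SF_end; simpl.
    rewrite RInt_point; unfold stieltjes_sum, zero; simpl.
    rewrite Rminus_0_r, Rabs_R0; lra.
  - intros x xi s Hs Hx IH; rewrite SF_end_cons, seq_step_cons; simpl; intros Ha Hb Hd.
    assert (He := SF_h_le_end s Hs).
    assert (Hd1 := Rle_lt_trans _ _ _ (Rmax_l _ _) Hd).
    assert (Hd2 := Rle_lt_trans _ _ _ (Rmax_r _ _) Hd).
    specialize (IH ltac:(lra) Hb Hd2).
    rewrite stieltjes_sum_cons; simpl.
    assert (Hsub : forall u v, a <= u -> u <= v -> v <= b ->
              ex_RInt (fun x => f x * phi x) u v).
    { intros u v Hu Huv Hv.
      apply (ex_RInt_Chasles_2 (V := R_CompleteNormedModule)) with a; [lra |].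
      apply (ex_RInt_Chasles_1 (V := R_CompleteNormedModule)) with b; [lra | exact Hex]. }
    rewrite <- (RInt_Chasles (V := R_CompleteNormedModule) _ x (SF_h s) (SF_end s))
      by (apply Hsub; lra).
    set (J := RInt _ (SF_h s) (SF_end s)) in *; set (K := RInt _ x (SF_h s)).
    assert (HK : Rabs (f xi * (g (SF_h s) - g x) - K) <= (SF_h s - x) * (eps * M)).
    { apply (norm_RInt_le_const (V := R_NormedModule)
        (fun y => minus (scal (f xi) (phi y)) (f y * phi y))); [lra | |].
      - intros y Hy; unfold minus, plus, opp, scal, norm; simpl; unfold abs, mult; simpl.
        replace (f xi * phi y + - (f y * phi y)) with ((f xi - f y) * phi y) by ring.
        rewrite Rabs_mult; apply Rmult_le_compat; try apply Rabs_pos.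
        + apply Hf; [lra | lra |].
          apply Rle_lt_trans with (2 := Hd1).
          rewrite (Rabs_pos_eq (SF_h s - x)) by lra.
          apply Rabs_le; lra.
        + apply HM; lra.
      - apply (is_RInt_minus (V := R_NormedModule)).
        + apply (is_RInt_scal (V := R_NormedModule)), Hg; lra.
        + apply (RInt_correct (V := R_CompleteNormedModule)), Hsub; lra. }
    unfold plus; simpl.
    replace (f xi * (g (SF_h s) - g x) + stieltjes_sum f g s - (K + J)) with
      ((f xi * (g (SF_h s) - g x) - K) + (stieltjes_sum f g s - J)) by ring.
    eapply Rle_trans; [apply Rabs_triang |].
    replace ((SF_end s - x) * (eps * M)) with
      ((SF_h s - x) * (eps * M) + (SF_end s - SF_h s) * (eps * M)) by ring.
    now apply Rplus_le_compat.
Qed.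

Lemma is_RSInt_density f g phi a b M I : a < b ->
  (forall x, a <= x <= b -> continuous f x) ->
  (forall x, a <= x <= b -> Rabs (phi x) <= M) ->
  (forall x y, a <= x -> x <= y -> y <= b -> is_RInt phi x y (g y - g x)) ->
  is_RInt (fun x => f x * phi x) a b I ->
  is_RSInt f g a b I.
Proof.
  intros Hab Hf HM Hg HI.
  assert (HM0 : 0 <= M).
  { apply Rle_trans with (2 := HM a ltac:(lra)), Rabs_pos. }
  apply filterlim_locally; intros eps.
  (* This modulus leaves a total error of at most [eps * (M / (M + 1))]; the added 1 covers M = 0
     and makes the bound strict. *)
  assert (He : 0 < eps / ((b - a) * (M + 1))).
  { apply Rdiv_lt_0_compat; [apply cond_pos | apply Rmult_lt_0_compat; lra]. }
  destruct (unifcont_normed_1d (V := R_NormedModule) f a b Hf (mkposreal _ He))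
    as [delta Hdelta].
  exists delta; intros s Hstep [Hs [Ha Hb]].
  rewrite Rmin_left in Ha by lra; rewrite Rmax_right in Hb by lra.
  change (seq.last (SF_h s) (SF_lx s)) with (SF_end s) in Hb.
  rewrite sign_eq_1 by lra; rewrite Rmult_1_l.
  assert (H := stieltjes_sum_density f g phi a b M (eps / ((b - a) * (M + 1))) delta s).
  rewrite Ha, Hb, (is_RInt_unique (V := R_CompleteNormedModule) _ _ _ _ HI) in H.
  change (Rabs (stieltjes_sum f g s - I) < eps).
  eapply Rle_lt_trans.
  - apply H; try lra; try assumption.
    + intros x y Hx Hy Hxy; rewrite Rabs_minus_sym; apply Rlt_le.
      exact (Hdelta x y Hx Hy Hxy).
    + eexists; exact HI.
  - assert (Hp := cond_pos eps).
    replace ((b - a) * (eps / ((b - a) * (M + 1)) * M)) with (eps * (M / (M + 1)))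
      by (field; lra).
    rewrite <- (Rmult_1_r eps) at 2; apply Rmult_lt_compat_l; [exact Hp |].
    apply Rlt_div_l; lra.
Qed.

(** * Periodised Bernoulli polynomials and sawtooth signatures *)

(** The periodised $\beta_m$; dividing by the factorial removes the factor $m+1$ from
    $P_{m+1}'=(m+1)P_m$. *)
Definition bernoulli_fun (m : nat) (t : R) : R :=
  bernoulli_poly m (frac_part t) / INR (fact m).

Lemma is_derive_bernoulli_poly_fact m s :
  is_derive (fun s => bernoulli_poly (S m) s / INR (fact (S m))) s
    (bernoulli_poly m s / INR (fact m)).
Proof.
  apply is_derive_ext with (fun s => / INR (fact (S m)) * bernoulli_poly (S m) s).
  { intros t; apply Rmult_comm. }
  evar_last; [apply is_derive_scal, is_derive_bernoulli_poly |].
  rewrite fact_simpl, mult_INR.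
  assert (H1 := INR_fact_neq_0 m); assert (H2 := not_0_INR (S m) ltac:(lia)).
  field; auto.
Qed.

Lemma continuous_bernoulli_poly_fact m s :
  continuous (fun s => bernoulli_poly m s / INR (fact m)) s.
Proof.
  apply (continuous_scal_l (K := R_AbsRing) (V := R_NormedModule)
    (bernoulli_poly m) (/ INR (fact m))).
  apply continuous_bernoulli_poly.
Qed.

Lemma frac_part_unit n t : INR n <= t < INR n + 1 -> frac_part t = t - INR n.
Proof.
  intros Ht.
  assert (H : 0 <= t - INR n < 1) by lra.
  destruct (Int_part_frac_part_spec t (Z.of_nat n) (t - INR n) H) as [_ ->].
  - rewrite <- INR_IZR_INZ; ring.
  - reflexivity.
Qed.

Lemma frac_part_INR n : frac_part (INR n) = 0.
Proof. rewrite (frac_part_unit n); lra. Qed.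

Lemma bernoulli_fun_unit_open m n t : INR n <= t < INR n + 1 ->
  bernoulli_fun m t = bernoulli_poly m (t - INR n) / INR (fact m).
Proof. intros Ht; unfold bernoulli_fun; now rewrite (frac_part_unit n). Qed.

Lemma bernoulli_fun_INR m n : bernoulli_fun m (INR n) = bernoulli_fun m 0.
Proof.
  unfold bernoulli_fun; rewrite frac_part_INR; change 0 with (INR 0) at 2.
  now rewrite frac_part_INR.
Qed.

(** The two conventions differ at index 1 only, so from 2 on either direction may be used;
    [backward] serves below as a neutral choice. *)
Lemma bernoulli_fun_0 d m : (2 <= m)%nat ->
  bernoulli_fun m 0 = bernoulli d m / INR (fact m).
Proof.
  intros Hm; unfold bernoulli_fun; change 0 with (INR 0) at 1; rewrite frac_part_INR.
  destruct d, m as [| [| m]]; reflexivity || lia.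
Qed.

(** From degree 2 on $P_m(1)=P_m(0)$, so the polynomial expression extends to the right end, where
    the fractional part has dropped to 0. *)
Lemma bernoulli_fun_unit m n t : (2 <= m)%nat -> INR n <= t <= INR n + 1 ->
  bernoulli_fun m t = bernoulli_poly m (t - INR n) / INR (fact m).
Proof.
  intros Hm [Hn [Ht | ->]]; [now apply bernoulli_fun_unit_open |].
  rewrite <- S_INR, bernoulli_fun_INR, (bernoulli_fun_0 backward) by exact Hm.
  rewrite S_INR; replace (INR n + 1 - INR n) with 1 by ring.
  rewrite bernoulli_poly_1_eq_0 by exact Hm.
  destruct m as [| [| m]]; reflexivity || lia.
Qed.

Lemma bernoulli_fun_bounded m :
  exists M, forall t, Rabs (bernoulli_fun m t) <= M.
Proof.
  set (u := fun s => Rabs (bernoulli_poly m s / INR (fact m))).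
  destruct (continuity_ab_maj u 0 1) as [x [Hx _]]; [lra | |].
  - intros c _; apply continuity_pt_filterlim.
    apply (continuous_comp (fun s => bernoulli_poly m s / INR (fact m)) Rabs).
    + apply continuous_bernoulli_poly_fact.
    + apply continuous_Rabs.
  - exists (u x); intros t; apply (Hx (frac_part t)).
    destruct (base_fp t); lra.
Qed.

Lemma continuous_bernoulli_poly_fact_shift m n t :
  continuous (fun t => bernoulli_poly m (t - INR n) / INR (fact m)) t.
Proof.
  apply (continuous_comp (fun t => t - INR n)
    (fun s => bernoulli_poly m s / INR (fact m))).
  - apply (ex_derive_continuous (V := R_NormedModule)); auto_derive; trivial.
  - apply continuous_bernoulli_poly_fact.
Qed.

Lemma is_derive_bernoulli_poly_fact_shift m n t :
  is_derive (fun t => bernoulli_poly (S m) (t - INR n) / INR (fact (S m))) t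
    (bernoulli_poly m (t - INR n) / INR (fact m)).
Proof.
  evar_last; [apply (is_derive_comp (fun s => bernoulli_poly (S m) s / INR (fact (S m)))) |].
  - apply is_derive_bernoulli_poly_fact.
  - auto_derive; [trivial | reflexivity].
  - unfold scal; simpl; unfold mult; simpl; ring.
Qed.

(** The integrand is compared with a polynomial on an open interval only, which tolerates the jump
    of $\beta_1$; the primitive has degree at least 2, so its formula holds up to both ends. *)
Lemma is_RInt_bernoulli_fun_unit m n x y : (1 <= m)%nat ->
  INR n <= x -> x <= y -> y <= INR n + 1 ->
  is_RInt (bernoulli_fun m) x y (bernoulli_fun (S m) y - bernoulli_fun (S m) x).
Proof.
  intros Hm Hx Hxy Hy.
  apply is_RInt_ext with (fun t => bernoulli_poly m (t - INR n) / INR (fact m)).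
  { rewrite Rmin_left, Rmax_right by lra; intros t Ht.
    rewrite (bernoulli_fun_unit_open m n); lra. }
  rewrite !(bernoulli_fun_unit (S m) n) by (lia || lra).
  apply (is_RInt_derive (V := R_CompleteNormedModule)
    (fun t => bernoulli_poly (S m) (t - INR n) / INR (fact (S m)))).
  - intros t _; apply is_derive_bernoulli_poly_fact_shift.
  - intros t _; apply continuous_bernoulli_poly_fact_shift.
Qed.

Lemma is_RInt_bernoulli_fun_0 m n : (1 <= m)%nat ->
  forall y, INR n <= y <= INR n + 1 ->
  is_RInt (bernoulli_fun m) 0 y (bernoulli_fun (S m) y - bernoulli_fun (S m) 0).
Proof.
  intros Hm; induction n as [| n IH]; intros y Hy.
  - apply (is_RInt_bernoulli_fun_unit m 0); simpl in *; lra || assumption.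
  - rewrite S_INR in Hy.
    replace (bernoulli_fun (S m) y - bernoulli_fun (S m) 0) with
      (plus (bernoulli_fun (S m) (INR n + 1) - bernoulli_fun (S m) 0)
            (bernoulli_fun (S m) y - bernoulli_fun (S m) (INR n + 1)))
      by (unfold plus; simpl; ring).
    apply (is_RInt_Chasles (V := R_NormedModule)) with (INR n + 1).
    + apply IH; lra.
    + apply (is_RInt_bernoulli_fun_unit m (S n)); rewrite ?S_INR; lra || assumption.
Qed.

Lemma is_RInt_bernoulli_fun m x y : (1 <= m)%nat -> 0 <= x -> 0 <= y ->
  is_RInt (bernoulli_fun m) x y (bernoulli_fun (S m) y - bernoulli_fun (S m) x).
Proof.
  intros Hm Hx Hy.
  destruct (nfloor_ex x Hx) as [n Hn]; destruct (nfloor_ex y Hy) as [k Hk].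
  replace (bernoulli_fun (S m) y - bernoulli_fun (S m) x) with
    (plus (opp (bernoulli_fun (S m) x - bernoulli_fun (S m) 0))
          (bernoulli_fun (S m) y - bernoulli_fun (S m) 0))
    by (unfold plus, opp; simpl; ring).
  apply (is_RInt_Chasles (V := R_NormedModule)) with 0.
  - apply (is_RInt_swap (V := R_NormedModule)).
    apply (is_RInt_bernoulli_fun_0 m n); [exact Hm | lra].
  - apply (is_RInt_bernoulli_fun_0 m k); [exact Hm | lra].
Qed.

(** * Sawtooth signatures and optimal tensors of a linear path *)

Lemma bernoulli_1 d : bernoulli d 1 = match d with forward => / 2 | backward => - / 2 end.
Proof. destruct d; simpl; rewrite bernoulli_poly_1_0; ring. Qed.

(** Forward, the increment is $\lambda(t-[t])$; backward, it is $\lambda(t-[t]-1)$. Since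
    $\beta_1=t-[t]-\frac12$, the remaining constants are $\pm\frac12=B_1^\pm$. *)
Lemma sawtooth_1 d lambda c t :
  sawtooth d (fun t => lambda * t) c 1 t =
  lambda * (bernoulli_fun 1 t + bernoulli d 1) + c 1%nat.
Proof.
  simpl sawtooth; unfold bernoulli_fun.
  rewrite bernoulli_1, bernoulli_poly_1; unfold frac_part; simpl fact; simpl INR.
  destruct d; simpl corner; [field |].
  assert (H := base_Int_part t).
  rewrite <- (Int_part_spec (t + 1) (Int_part t + 1)); rewrite plus_IZR; [field | lra].
Qed.

(** The integration constant stays free: it is 0 when the optimal tensor is computed, and the
    mean-zero one in [sawtooth_bernoulli]. *)
Lemma sawtooth_step d lambda c l :
  (forall t, 0 <= t ->
     sawtooth d (fun t => lambda * t) c (S l) t = lambda ^ S l * bernoulli_fun (S l) t) ->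
  forall t, 0 <= t ->
    sawtooth d (fun t => lambda * t) c (S (S l)) t =
    c (S (S l)) + lambda ^ S (S l) * (bernoulli_fun (S (S l)) t - bernoulli_fun (S (S l)) 0).
Proof.
  intros Hl t Ht.
  change (sawtooth d (fun t => lambda * t) c (S (S l)) t) with
    (c (S (S l)) + RSInt (sawtooth d (fun t => lambda * t) c (S l)) (fun t => lambda * t) 0 t).
  f_equal.
  rewrite (is_RSInt_unique _ _ _ _ (lambda * (lambda ^ S l *
    (bernoulli_fun (S (S l)) t - bernoulli_fun (S (S l)) 0)))).
  - rewrite <- Rmult_assoc; reflexivity.
  - apply is_RSInt_linear; [exact Ht | reflexivity |].
    apply is_RInt_ext with (fun s => lambda ^ S l * bernoulli_fun (S l) s).
    + rewrite Rmin_left by exact Ht; intros s Hs; symmetry; apply Hl; lra.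
    + apply (is_RInt_scal (V := R_NormedModule)).
      apply is_RInt_bernoulli_fun; lia || lra.
Qed.

(** The datum at level 1 cancels the mean of the raw sawtooth; at level k the datum is the value at
    0 of $\lambda^k\beta_k$, so each integration reproduces the next function exactly. *)
Lemma sawtooth_bernoulli d lambda c l : (1 <= l)%nat ->
  c 1%nat = - (lambda * bernoulli d 1) ->
  (forall k, (2 <= k <= l)%nat -> c k = lambda ^ k * bernoulli_fun k 0) ->
  forall t, 0 <= t ->
    sawtooth d (fun t => lambda * t) c l t = lambda ^ l * bernoulli_fun l t.
Proof.
  intros Hl H1; induction l as [| [| l] IH]; [lia | |]; intros Hc t Ht.
  - rewrite sawtooth_1, H1; ring.
  - rewrite sawtooth_step; [rewrite Hc by lia; ring | | exact Ht].
    apply IH; [lia | intros k Hk; apply Hc; lia].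
Qed.

(** Both integrals carry the speed once, through $|dX_t|=\lambda\,dt$, and it cancels in the
    quotient. *)
Lemma path_mean_linear N lambda g I : (1 <= N)%nat -> 0 < lambda ->
  is_RInt g 0 (INR N) I -> path_mean N (fun t => lambda * t) g = I / INR N.
Proof.
  intros HN Hlambda HI.
  assert (HN0 : 0 < INR N) by (apply lt_0_INR; lia).
  assert (Htv : forall x, 0 <= x <= INR N ->
            total_variation (fun t => lambda * t) 0 x = lambda * x).
  { intros x Hx; rewrite total_variation_linear by lra; ring. }
  unfold path_mean.
  rewrite (is_RSInt_unique (fun _ => 1) _ _ _ (lambda * ((INR N - 0) * 1))),
    (is_RSInt_unique g _ _ _ (lambda * I)).
  - field; lra.
  - apply is_RSInt_linear; [lra | exact Htv | exact HI].
  - apply is_RSInt_linear; [lra | exact Htv |].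
    apply (is_RInt_const (V := R_NormedModule)).
Qed.

(** By strong induction the levels below l are already $\lambda^k\beta_k$. For $l\ge2$ the truncated
    datum makes level l start at 0, hence equal to $\lambda^l(\beta_l-\beta_l(0))$; its mean is
    $-\lambda^l\beta_l(0)$, and the sign in the definition restores the Bernoulli number. *)
Lemma optimal_tensor_bernoulli d N lambda l : (1 <= N)%nat -> 0 < lambda -> (1 <= l)%nat ->
  optimal_tensor d N (fun t => lambda * t) l = lambda ^ l * (bernoulli d l / INR (fact l)).
Proof.
  intros HN Hlambda.
  assert (HN0 : 0 < INR N) by (apply lt_0_INR; lia).
  (* The primitive $\beta_{m+1}$ takes equal values at 0 and N. *)
  assert (Hmean : forall m, (1 <= m)%nat -> is_RInt (bernoulli_fun m) 0 (INR N) 0).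
  { intros m Hm; replace 0 with (bernoulli_fun (S m) (INR N) - bernoulli_fun (S m) 0) at 2
      by (rewrite bernoulli_fun_INR; ring).
    apply is_RInt_bernoulli_fun; lra || assumption. }
  assert (Haff : forall m c k, (1 <= m)%nat ->
            is_RInt (fun t => c * (bernoulli_fun m t + k)) 0 (INR N) (c * (k * INR N))).
  { intros m c k Hm; apply (is_RInt_scal (V := R_NormedModule)).
    replace (k * INR N) with (plus 0 (scal (INR N - 0) k))
      by (unfold plus, scal; simpl; unfold mult; simpl; ring).
    apply (is_RInt_plus (V := R_NormedModule)); [now apply Hmean |].
    apply (is_RInt_const (V := R_NormedModule)). }
  induction l as [l IH] using (well_founded_induction Nat.lt_wf_0); intros Hl.
  destruct l as [| [| l]]; [lia | |].
  - rewrite optimal_tensor_1.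
    rewrite (path_mean_linear _ _ _ (lambda * (bernoulli d 1 * INR N)) HN Hlambda).
    + simpl fact; simpl INR; field; lra.
    + apply is_RInt_ext with (2 := Haff 1%nat lambda (bernoulli d 1) (Nat.le_refl 1)).
      intros t _; rewrite sawtooth_1; unfold tensor_one; simpl; ring.
  - rewrite optimal_tensor_rec by lia.
    set (c := bar_below _ _).
    rewrite (path_mean_linear _ _ _
      (lambda ^ S (S l) * (- bernoulli_fun (S (S l)) 0 * INR N)) HN Hlambda).
    + rewrite (bernoulli_fun_0 d) by lia; field; split; [apply INR_fact_neq_0 | lra].
    + apply is_RInt_ext with (2 := Haff (S (S l)) (lambda ^ S (S l))
                                   (- bernoulli_fun (S (S l)) 0) ltac:(lia)).
      rewrite Rmin_left by lra; intros t Ht.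
      rewrite sawtooth_step.
      (* The datum is cut off strictly below its own level, so the integration constant here is
         0. *)
      * unfold c, bar_below at 1; rewrite Nat.ltb_irrefl; rewrite Rplus_0_l; reflexivity.
      * apply sawtooth_bernoulli; [lia | |].
        (* The sign change made by [bar] at level 1 is what turns the mean into its correction. *)
        -- unfold c, bar_below, bar; simpl Nat.ltb; simpl Nat.eqb; cbv iota.
           rewrite IH by lia; simpl; field.
        -- intros k Hk; unfold c, bar_below, bar.
           replace (Nat.ltb k (S (S l))) with true by (symmetry; apply Nat.ltb_lt; lia).
           replace (Nat.eqb k 1) with false by (symmetry; apply Nat.eqb_neq; lia).
           rewrite IH by lia; now rewrite (bernoulli_fun_0 d) by lia.
      * lra.
Qed.

Lemma sawtooth_optimal d N lambda l t : (1 <= N)%nat -> 0 < lambda -> (1 <= l)%nat ->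
  0 <= t ->
  sawtooth d (fun t => lambda * t) (bar (optimal_tensor d N (fun t => lambda * t))) l t =
  lambda ^ l * bernoulli_fun l t.
Proof.
  intros HN Hlambda Hl Ht; apply sawtooth_bernoulli; [exact Hl | | | exact Ht].
  - unfold bar; simpl Nat.eqb; cbv iota.
    rewrite optimal_tensor_bernoulli by (lia || assumption); simpl; field.
  - intros k Hk; unfold bar.
    replace (Nat.eqb k 1) with false by (symmetry; apply Nat.eqb_neq; lia).
    rewrite optimal_tensor_bernoulli by (lia || lra).
    now rewrite (bernoulli_fun_0 d) by lia.
Qed.

(** * Euler-Maclaurin *)


Lemma is_RInt_mult_bernoulli_fun_unit m n (g : R -> R) I :
  is_RInt (fun t => g t * (bernoulli_poly m (t - INR n) / INR (fact m)))
    (INR n) (INR (S n)) I ->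
  is_RInt (fun t => g t * bernoulli_fun m t) (INR n) (INR (S n)) I.
Proof.
  apply is_RInt_ext; rewrite S_INR, Rmin_left, Rmax_right by lra.
  intros t Ht; rewrite (bernoulli_fun_unit_open m n); [reflexivity | lra].
Qed.

Lemma ex_RInt_mult_bernoulli_fun_unit m n (g : R -> R) : (forall t, continuous g t) ->
  ex_RInt (fun t => g t * bernoulli_fun m t) (INR n) (INR (S n)).
Proof.
  intros Hg.
  destruct (ex_RInt_continuous (V := R_CompleteNormedModule)
    (fun t => g t * (bernoulli_poly m (t - INR n) / INR (fact m)))
    (INR n) (INR (S n))) as [I HI].
  - intros t _; apply (continuous_mult g); [apply Hg |].
    apply continuous_bernoulli_poly_fact_shift.
  - exists I; now apply is_RInt_mult_bernoulli_fun_unit.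
Qed.

Lemma ex_RInt_mult_bernoulli_fun m N (g : R -> R) : (forall t, continuous g t) ->
  ex_RInt (fun t => g t * bernoulli_fun m t) 0 (INR N).
Proof.
  intros Hg; induction N as [| N IH]; [apply ex_RInt_point |].
  apply (ex_RInt_Chasles (V := R_NormedModule)) with (INR N); [exact IH |].
  now apply ex_RInt_mult_bernoulli_fun_unit.
Qed.

Lemma RInt_mult_bernoulli_fun_S m N (g : R -> R) : (forall t, continuous g t) ->
  RInt (fun t => g t * bernoulli_fun m t) 0 (INR (S N)) =
  RInt (fun t => g t * bernoulli_fun m t) 0 (INR N) +
  RInt (fun t => g t * bernoulli_fun m t) (INR N) (INR (S N)).
Proof.
  intros Hg; symmetry; apply (RInt_Chasles (V := R_CompleteNormedModule)).
  - now apply ex_RInt_mult_bernoulli_fun.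
  - now apply ex_RInt_mult_bernoulli_fun_unit.
Qed.

(** The boundary terms use the polynomial at 1 and at 0, not its periodisation; this keeps m = 0
    available, where the two values $\pm\frac12$ differ. *)
Lemma RInt_bernoulli_fun_by_parts_unit m n (g g' : R -> R) :
  (forall t, is_derive g t (g' t)) -> (forall t, continuous g' t) ->
  RInt (fun t => g t * bernoulli_fun m t) (INR n) (INR (S n)) =
  (g (INR (S n)) * bernoulli_poly (S m) 1 - g (INR n) * bernoulli_poly (S m) 0)
    / INR (fact (S m))
  - RInt (fun t => g' t * bernoulli_fun (S m) t) (INR n) (INR (S n)) :> R.
Proof.
  intros Dg Cg'.
  set (c := fun k t => bernoulli_poly k (t - INR n) / INR (fact k)).
  assert (Hex : ex_RInt (fun t => g' t * c (S m) t) (INR n) (INR (S n))).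
  { apply (ex_RInt_continuous (V := R_CompleteNormedModule)); intros t _.
    apply (continuous_mult g' (c (S m))); [apply Cg' |].
    apply continuous_bernoulli_poly_fact_shift. }
  assert (HI := RInt_correct (V := R_CompleteNormedModule) _ _ _ Hex).
  set (I := RInt (fun t => g' t * c (S m) t) (INR n) (INR (S n))) in HI.
  assert (HP := is_RInt_scal_derive_r (V := R_CompleteNormedModule) g (c (S m)) g' (c m)
    (INR n) (INR (S n)) I (fun t _ => Dg t)
    (fun t _ => is_derive_bernoulli_poly_fact_shift m n t)
    (fun t _ => Cg' t) (fun t _ => continuous_bernoulli_poly_fact_shift m n t) HI).
  apply is_RInt_mult_bernoulli_fun_unit in HI.
  apply is_RInt_mult_bernoulli_fun_unit in HP.
  rewrite (is_RInt_unique (V := R_CompleteNormedModule) _ _ _ _ HI).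
  rewrite (is_RInt_unique (V := R_CompleteNormedModule) _ _ _ _ HP).
  transitivity (g (INR (S n)) * c (S m) (INR (S n)) - g (INR n) * c (S m) (INR n) - I);
    [reflexivity |].
  unfold c; rewrite S_INR; replace (INR n + 1 - INR n) with 1 by ring.
  rewrite Rminus_diag; field; apply INR_fact_neq_0.
Qed.

(** For $m\ge1$ both ends of a unit interval carry the same coefficient, so the boundary terms
    telescope. *)
Lemma RInt_bernoulli_fun_by_parts m N (g g' : R -> R) : (1 <= m)%nat ->
  (forall t, is_derive g t (g' t)) -> (forall t, continuous g' t) ->
  RInt (fun t => g t * bernoulli_fun m t) 0 (INR N) =
  bernoulli_fun (S m) 0 * boundary_jump g N
  - RInt (fun t => g' t * bernoulli_fun (S m) t) 0 (INR N) :> R.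
Proof.
  intros Hm Dg Cg'.
  assert (Cg : forall t, continuous g t).
  { intros t; apply (ex_derive_continuous (V := R_NormedModule)); eexists; apply Dg. }
  unfold boundary_jump; induction N as [| N IH].
  - change (INR 0) with 0; rewrite !RInt_point; unfold zero; simpl; ring.
  - rewrite !RInt_mult_bernoulli_fun_S, IH by assumption.
    rewrite (RInt_bernoulli_fun_by_parts_unit m N g g' Dg Cg').
    rewrite bernoulli_poly_1_eq_0, (bernoulli_fun_0 backward) by lia.
    destruct m as [| m]; [lia |]; unfold bernoulli.
    field; apply INR_fact_neq_0.
Qed.

Lemma integer_range_sum_S d n f :
  integer_range_sum d (S (S n)) f = integer_range_sum d (S n) f +
    f (INR match d with forward => S (S n) | backward => S n end).
Proof.
  destruct d; unfold integer_range_sum.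
  - apply (sum_n_Sm (fun k => f (INR k))); lia.
  - replace (S (S n) - 1)%nat with (S n) by lia; replace (S n - 1)%nat with n by lia.
    apply (sum_n_Sm (fun k => f (INR k))); lia.
Qed.

Lemma integer_range_sum_1 d f :
  integer_range_sum d 1 f = f match d with forward => 1 | backward => 0 end.
Proof. destruct d; unfold integer_range_sum; now rewrite sum_n_n. Qed.

(** Integrating $g\beta_0$ by parts on each unit interval gives the trapezoidal rule; adding or
    subtracting half the total jump turns it into the right or left sum. *)
Lemma euler_maclaurin_1 d N (g g' : R -> R) : (1 <= N)%nat ->
  (forall t, is_derive g t (g' t)) -> (forall t, continuous g' t) ->
  integer_range_sum d N g =
  RInt g 0 (INR N) + bernoulli d 1 * boundary_jump g N
  + RInt (fun t => g' t * bernoulli_fun 1 t) 0 (INR N).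
Proof.
  intros HN Dg Cg'.
  assert (Cg : forall t, continuous g t).
  { intros t; apply (ex_derive_continuous (V := R_NormedModule)); eexists; apply Dg. }
  assert (E : forall t, g t = g t * bernoulli_fun 0 t).
  { intros t; unfold bernoulli_fun; rewrite bernoulli_poly_0; simpl; field. }
  rewrite (RInt_ext g (fun t => g t * bernoulli_fun 0 t)) by (intros t _; apply E).
  unfold boundary_jump; rewrite bernoulli_1.
  destruct N as [| N]; [lia |]; clear HN; induction N as [| N IH].
  - assert (HP := RInt_bernoulli_fun_by_parts_unit 0 0 g g' Dg Cg').
    change (INR 0) with 0 in HP.
    rewrite integer_range_sum_1, HP, bernoulli_poly_1_1, bernoulli_poly_1_0.
    simpl; destruct d; field.
  - rewrite integer_range_sum_S, IH, !(RInt_mult_bernoulli_fun_S _ (S N)) by assumption.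
    rewrite (RInt_bernoulli_fun_by_parts_unit 0 (S N) g g' Dg Cg').
    rewrite bernoulli_poly_1_1, bernoulli_poly_1_0.
    change (INR (fact 1)) with 1; destruct d; field.
Qed.

Lemma C_class_continuous m f k t : (k <= m)%nat -> C_class m f ->
  continuous (Derive_n f k) t.
Proof.
  intros Hk [Df Cf]; destruct (Nat.eq_dec k m) as [-> | Hne]; [apply Cf |].
  apply (ex_derive_continuous (V := R_NormedModule)), (Df (S k)); lia.
Qed.

Lemma C_class_is_derive m f k t : (k < m)%nat -> C_class m f ->
  is_derive (Derive_n f k) t (Derive_n f (S k) t).
Proof. intros Hk [Df _]; apply Derive_correct, (Df (S k)); lia. Qed.

Lemma C_class_pred m f : C_class (S m) f -> C_class m f.
Proof.
  intros Hf; split.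
  - intros k x Hk; apply Hf; lia.
  - intros x; apply (C_class_continuous (S m)); [lia | exact Hf].
Qed.

Lemma euler_maclaurin d N m f : (1 <= N)%nat -> (1 <= m)%nat -> C_class m f ->
  integer_range_sum d N f =
  RInt f 0 (INR N)
  + sum_n_m (fun l => bernoulli d l / INR (fact l) *
      boundary_jump (Derive_n f (l - 1)) N) 1 m
  + (-1) ^ (m + 1) *
      RInt (fun t => Derive_n f m t * bernoulli_fun m t) 0 (INR N).
Proof.
  intros HN Hm; induction m as [| [| m] IH]; [lia | |]; intros Hf.
  - rewrite sum_n_n, (euler_maclaurin_1 d N f (Derive_n f 1)); [| exact HN | |].
    + change (Derive_n f (1 - 1)) with f; simpl fact; simpl INR; simpl pow; field.
    + intros t; apply (C_class_is_derive 1); [lia | exact Hf].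
    + intros t; apply (C_class_continuous 1); [lia | exact Hf].
  - rewrite IH by (lia || now apply C_class_pred).
    rewrite (RInt_bernoulli_fun_by_parts (S m) N _ (Derive_n f (S (S m)))).
    + rewrite (sum_n_Sm _ 1 (S m)) by lia.
      rewrite <- (bernoulli_fun_0 d) by lia.
      (* The new boundary term inherits the sign of the old remainder; parity removes it, since the
         coefficient vanishes whenever that sign is -1. *)
      assert (E : (-1) ^ (S m + 1) * bernoulli_fun (S (S m)) 0 = bernoulli_fun (S (S m)) 0).
      { rewrite (bernoulli_fun_0 backward) by lia; unfold bernoulli.
        rewrite <- (bernoulli_poly_0_parity (S (S m))) at 2 by lia.
        rewrite Nat.add_1_r; unfold Rdiv; ring. }
      replace (S (S m) - 1)%nat with (S m) by lia.
      replace ((-1) ^ (S (S m) + 1)) with (- (-1) ^ (S m + 1)) by (simpl; ring).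
      rewrite <- E at 2; unfold plus; simpl; ring.
    + lia.
    + intros t; apply (C_class_is_derive (S (S m))); [lia | exact Hf].
    + intros t; apply (C_class_continuous (S (S m))); [lia | exact Hf].
Qed.

Lemma RInt_mult_bernoulli_fun m N (g : R -> R) : (forall t, continuous g t) ->
  RInt (fun t => g t * bernoulli_fun m t) 0 (INR N) =
  / INR (fact m) * RInt (fun t => g t * bernoulli_poly m (frac_part t)) 0 (INR N) :> R.
Proof.
  intros Hg; destruct (ex_RInt_mult_bernoulli_fun m N g Hg) as [I HI].
  rewrite (is_RInt_unique (V := R_CompleteNormedModule) _ _ _ _ HI).
  rewrite (is_RInt_unique (V := R_CompleteNormedModule) _ _ _ (INR (fact m) * I)).
  - rewrite <- Rmult_assoc, Rinv_l, Rmult_1_l; [reflexivity | apply INR_fact_neq_0].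
  - assert (E : forall t, INR (fact m) * (g t * bernoulli_fun m t) =
                          g t * bernoulli_poly m (frac_part t)).
    { intros t; unfold bernoulli_fun; field; apply INR_fact_neq_0. }
    apply is_RInt_ext with (fun t => INR (fact m) * (g t * bernoulli_fun m t)).
    + intros t _; apply E.
    + now apply (is_RInt_scal (V := R_NormedModule)).
Qed.

Lemma euler_sum_integers d N f : (1 <= N)%nat ->
  euler_sum d N f (fun t => t) = integer_range_sum d N f.
Proof.
  intros HN; unfold euler_sum, integer_range_sum.
  destruct N as [| N]; [lia |]; replace (S N - 1)%nat with N by lia.
  assert (E : forall a k, a * (INR (S k) - INR k) = a).
  { intros a k; rewrite S_INR; ring. }
  destruct d; [rewrite <- sum_n_m_S |]; apply sum_n_m_ext; intros k; apply E.
Qed.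

Theorem theorem4p5 (N : nat) (hN : (1 <= N)%nat) (lambda : R) (hlambda : 0 < lambda)
    (d : direction) :
  let X := fun t : R => lambda * t in
  let b := optimal_tensor d N X in
  let Z := sawtooth d X (bar b) in
  (forall l : nat, (1 <= l)%nat ->
     b l = lambda ^ l * (bernoulli d l / INR (fact l))) /\
  (forall m : nat, (2 <= m)%nat ->
     Z m (INR N) = lambda ^ m * (bernoulli d m / INR (fact m))) /\
  (lambda = 1 ->
     (forall (l : nat) (t : R), (2 <= l)%nat -> 0 <= t <= INR N ->
        Z l t = / INR (fact l) * bernoulli_poly l (t - IZR (Int_part t))) /\
     (forall (m : nat) (f : R -> R), (1 <= m)%nat -> C_class m f ->
        (* the generalised formula *)
        euler_sum d N f X =
          RSInt (fun t => f (X t)) X 0 (INR N)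
          + boundary_jump (fun t => f (X t) * b 1%nat) N
          + sum_n_m (fun l => (-1) ^ l *
              boundary_jump (fun t => Derive_n f (l - 1) (X t) * Z l t) N) 2 m
          + (-1) ^ (m + 1) *
              RSInt (fun t => Derive_n f m (X t)) (Z (m + 1)%nat) 0 (INR N) /\
        (* the classical formula *)
        integer_range_sum d N f =
          RInt f 0 (INR N)
          + sum_n_m (fun l => bernoulli d l / INR (fact l) *
              boundary_jump (Derive_n f (l - 1)) N) 1 m
          + (-1) ^ (m + 1) / INR (fact m) *
              RInt (fun s => Derive_n f m s * bernoulli_poly m (s - IZR (Int_part s)))
                0 (INR N) /\
        (* their terms agree respectively *)
        euler_sum d N f X = integer_range_sum d N f /\
        RSInt (fun t => f (X t)) X 0 (INR N) = RInt f 0 (INR N) /\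
        boundary_jump (fun t => f (X t) * b 1%nat) N =
          bernoulli d 1 / INR (fact 1) * boundary_jump (Derive_n f 0) N /\
        (forall l : nat, (2 <= l <= m)%nat ->
           (-1) ^ l * boundary_jump (fun t => Derive_n f (l - 1) (X t) * Z l t) N =
           bernoulli d l / INR (fact l) * boundary_jump (Derive_n f (l - 1)) N) /\
        (-1) ^ (m + 1) *
          RSInt (fun t => Derive_n f m (X t)) (Z (m + 1)%nat) 0 (INR N) =
        (-1) ^ (m + 1) / INR (fact m) *
          RInt (fun s => Derive_n f m s * bernoulli_poly m (s - IZR (Int_part s)))
            0 (INR N))).
Proof.
  intros X b Z.
  assert (HN0 : 0 < INR N) by (apply lt_0_INR; lia).
  assert (Hb : forall l, (1 <= l)%nat -> b l = lambda ^ l * (bernoulli d l / INR (fact l))).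
  { intros l Hl; now apply optimal_tensor_bernoulli. }
  assert (HZ : forall l t, (1 <= l)%nat -> 0 <= t ->
            Z l t = lambda ^ l * bernoulli_fun l t).
  { intros l t Hl Ht; now apply sawtooth_optimal. }
  split; [exact Hb |]; split.
  { intros m Hm; rewrite HZ by (lia || lra).
    now rewrite bernoulli_fun_INR, (bernoulli_fun_0 d). }
  intros Hlambda.
  assert (HX : X = fun t => t).
  { apply functional_extensionality; intros t; unfold X; rewrite Hlambda; ring. }
  rewrite Hlambda in Hb, HZ.
  assert (HZ1 : forall l t, (1 <= l)%nat -> 0 <= t -> Z l t = bernoulli_fun l t).
  { intros l t Hl Ht; rewrite HZ, pow1 by assumption; ring. }
  assert (Hb1 : b 1%nat = bernoulli d 1 / INR (fact 1)).
  { rewrite Hb by lia; ring. }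
  (* All that is needed of the tensor and the signature is now in [Hb1] and [HZ1]; forgetting their
     bodies allows the path to be replaced by the identity. *)
  clearbody Z; clearbody b; clearbody X; subst X.
  split.
  { intros l t Hl Ht; rewrite HZ1 by (lia || lra).
    unfold bernoulli_fun, frac_part; field; apply INR_fact_neq_0. }
  intros m f Hm Hf.
  assert (Hsum := euler_sum_integers d N f hN).
  assert (Hmain : RSInt (fun t => f t) (fun t => t) 0 (INR N) = RInt f 0 (INR N)).
  { apply is_RSInt_unique; rewrite <- (Rmult_1_l (RInt f 0 (INR N))).
    apply is_RSInt_linear; [lra | intros; ring |].
    apply (RInt_correct (V := R_CompleteNormedModule)).
    apply (ex_RInt_continuous (V := R_CompleteNormedModule)); intros t _.
    apply (C_class_continuous m f 0); [lia | exact Hf]. }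
  assert (Hjump1 : boundary_jump (fun t => f t * b 1%nat) N =
            bernoulli d 1 / INR (fact 1) * boundary_jump (Derive_n f 0) N).
  { unfold boundary_jump; rewrite Hb1; simpl Derive_n; ring. }
  (* The signature takes the value $B_l/l!$ at both 0 and N, so it factors out of the jump, and
     parity absorbs the sign. *)
  assert (Hjump : forall l, (2 <= l <= m)%nat ->
            (-1) ^ l * boundary_jump (fun t => Derive_n f (l - 1) t * Z l t) N =
            bernoulli d l / INR (fact l) * boundary_jump (Derive_n f (l - 1)) N).
  { intros l Hl; unfold boundary_jump.
    rewrite !HZ1, bernoulli_fun_INR, (bernoulli_fun_0 backward) by (lia || lra).
    replace (bernoulli d l) with ((-1) ^ l * bernoulli_poly l 0).
    - destruct l; [lia |]; unfold bernoulli; field; apply INR_fact_neq_0.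
    - rewrite bernoulli_poly_0_parity by lia; destruct d, l as [| [| l]]; reflexivity || lia. }
  assert (Cm : forall t, continuous (Derive_n f m) t).
  { intros t; now apply (C_class_continuous m). }
  (* Level m + 1 of the signature is a primitive of the bounded $\beta_m$, so integrating against it
     is integrating against that density. *)
  assert (HRS : RSInt (fun t => Derive_n f m t) (Z (m + 1)%nat) 0 (INR N) =
            RInt (fun t => Derive_n f m t * bernoulli_fun m t) 0 (INR N)).
  { destruct (bernoulli_fun_bounded m) as [M HM].
    apply is_RSInt_unique, (is_RSInt_density _ _ (bernoulli_fun m) _ _ M).
    - exact HN0.
    - intros t _; apply Cm.
    - intros t _; apply HM.
    - intros x y Hx Hxy _; rewrite !HZ1, Nat.add_1_r by (lia || lra).
      apply is_RInt_bernoulli_fun; lia || lra.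
    - apply (RInt_correct (V := R_CompleteNormedModule)).
      now apply ex_RInt_mult_bernoulli_fun. }
  assert (Hrem : (-1) ^ (m + 1) * RSInt (fun t => Derive_n f m t) (Z (m + 1)%nat) 0 (INR N) =
            (-1) ^ (m + 1) / INR (fact m) *
              RInt (fun s => Derive_n f m s * bernoulli_poly m (s - IZR (Int_part s)))
                0 (INR N)).
  { rewrite HRS, RInt_mult_bernoulli_fun by exact Cm; unfold frac_part, Rdiv; ring. }
  assert (Hclassical := euler_maclaurin d N m f hN Hm Hf).
  rewrite <- HRS in Hclassical.
  split; [| split; [| split; [exact Hsum | split; [exact Hmain | split;
    [exact Hjump1 | split; [exact Hjump | exact Hrem]]]]]].
  (* The generalised formula follows from the classical one term by term, once the l = 1 summand is
     split off as the first boundary term. *)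
  - rewrite Hsum, Hclassical, Hmain, Hjump1.
    rewrite (sum_n_m_ext_loc (fun l => (-1) ^ l * _) (fun l => bernoulli d l / INR (fact l) *
              boundary_jump (Derive_n f (l - 1)) N) 2 m) by exact Hjump.
    rewrite (sum_Sn_m _ 1 m) by exact Hm.
    change (1 - 1)%nat with 0%nat; rewrite !Rplus_assoc; reflexivity.
  - rewrite <- Hrem; exact Hclassical.
Qed.
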